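(* Let $X$ be a Baire space which is Hausdorff and connected. Let $\sigma: X \rightarrow X$ be a homeomorphism, inducing the automorphism $\widetilde{\sigma}$ of $C(X)$ given by $\widetilde{\sigma}(f)=f\circ\sigma^{-1}$. Suppose $A$ is a subalgebra of $C(X)$ that is invariant under $\widetilde{\sigma}$ and its inverse, such that for every open set $U \subseteq X$ and $x \in U$ there is an $f \in A$ such that $f(x) \neq 0$ and $\mathrm{supp}(f) \subseteq U$. Let $A'$ be the commutant of $A$ in $A \rtimes_{\widetilde{\sigma}} \mathbb{Z}$. Then precisely one of the following situations occurs: (1) $A = A'$, which happens precisely when $\mathrm{Per}^{\infty}(X)$ is dense in $X$; (2) $A \subsetneq A'$ and there exist both subalgebras properly between $A$ and $A'$ which have the intersection property, and subalgebras properly between $A$ and $A'$ which do not. This happens precisely when $\mathrm{Per}^{\infty}(X)$ is not dense and $X$ is infinite; (3) $A \subsetneq A'$ and every subalgebra properly between $A$ and $A'$ has the intersection property. This happens precisely when $X$ consists of one point.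
   Context: $C(X)$ is the algebra of all continuous complex-valued functions on $X$. For $f\in A$, $\mathrm{supp}(f)=\{x\in X : f(x)\neq 0\}$ (no closure is taken). $\mathrm{Per}^{\infty}(X)=\{x\in X : \sigma^n(x)\neq x \text{ for all } n\in\mathbb{Z}\setminus\{0\}\}$ is the set of non-periodic points. For an associative commutative complex algebra $A$ and an algebra automorphism $\Psi : A \to A$ (here $\Psi$ is the restriction of $\widetilde{\sigma}$ to $A$), the crossed product $A \rtimes_{\Psi} \mathbb{Z}$ is the associative complex algebra of all finite formal sums $\sum_{n\in\mathbb{Z}} f_n\delta^n$ with $f_n\in A$, with coefficientwise addition and scalar multiplication, and with multiplication determined by $(f_n\delta^n)*(g_m\delta^m)=f_n\cdot\Psi^n(g_m)\,\delta^{n+m}$. The algebra $A$ is identified with the abelian subalgebra $\{f_0\delta^0 : f_0\in A\}$, and $A'$ is the set of all elements of the crossed product commuting with every element of $A$. A subalgebra $B$ of the crossed product is properly between $A$ and $A'$ if $A\subsetneq B\subsetneq A'$. A subalgebra has the intersection property if it intersects every non-zero two-sided ideal of the crossed product non-trivially (i.e. in more than $\{0\}$). *)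

(* Defs.v *)
From HB Require Import structures.
From mathcomp Require Import all_boot all_order all_algebra.
From mathcomp Require Import complex.
From mathcomp Require Import all_classical all_reals all_analysis.

Set Implicit Arguments.
Unset Strict Implicit.
Unset Printing Implicit Defensive.

Import Order.TTheory GRing.Theory Num.Theory.
Import numFieldNormedType.Exports.

Local Open Scope classical_set_scope.
Local Open Scope ring_scope.

Definition Baire_space (X : topologicalType) : Prop :=
  forall U : (set X)^nat,
    (forall n, open (U n) /\ dense (U n)) -> dense (\bigcap_n U n).

Definition homeomorphism_with_inverse (X : topologicalType)
    (sigma sigma' : X -> X) : Prop :=
  [/\ cancel sigma sigma', cancel sigma' sigma,
      continuous sigma & continuous sigma'].

(* Integer powers f^n of a bijection f with inverse g. *)
Definition iterz (T : Type) (f g : T -> T) (n : int) : T -> T :=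
  match n with
  | Posz m => iter m f
  | Negz m => iter m.+1 g
  end.

Definition nonperiodic (X : Type) (sigma sigma' : X -> X) : set X :=
  [set x | forall n : int, n != 0 -> iterz sigma sigma' n x <> x].

(* Algebras are not assumed unital, hence neither are subalgebras.  The product
   is a parameter, so that the definition applies both to the pointwise product
   of functions and to the product of the crossed product. *)
Definition is_subalgebra (K : pzRingType) (V : lmodType K) (mul : V -> V -> V)
    (B : set V) : Prop :=
  GRing.submod_closed [in B] /\ (forall u v, B u -> B v -> B (mul u v)).

Definition is_two_sided_ideal (K : pzRingType) (V : lmodType K)
    (mul : V -> V -> V) (P I : set V) : Prop :=
  [/\ I `<=` P, GRing.submod_closed [in I] &
      forall p i, P p -> I i -> I (mul p i) /\ I (mul i p)].

Section CrossedProduct.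
Variables (R : realType) (X : Type).

(* The regular module R[i]^o is the field R[i], seen as a module over itself;
   this is the form of R[i] that carries the usual topology. *)
Local Notation CX := (X -> R[i]^o).

Variables (sigma sigma' : X -> X) (A : set CX).

Definition sigma_tilde (f : CX) : CX := f \o sigma'.
Definition sigma_tilde_inv (f : CX) : CX := f \o sigma.

(* The family a : int -> CX stands for the formal sum of the a n delta^n. *)
Definition crossed_product : set (int -> CX) :=
  [set a | (forall n, A (a n)) /\ finite_set [set n | a n != 0]].

(* Coefficient of delta^n: the sum over k + m = n of f_k * Psi^k(g_m).  It has
   finitely many nonzero terms when a is in the crossed product. *)
Definition crossed_mul (a b : int -> CX) : int -> CX :=
  fun n => \sum_(k \in [set: int])
    a k * iterz sigma_tilde sigma_tilde_inv k (b (n - k)).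

Definition delta0 (f : CX) : int -> CX := fun n => if n == 0 then f else 0.

Definition base_algebra : set (int -> CX) := delta0 @` A.

Definition commutant : set (int -> CX) :=
  [set a | crossed_product a /\
     forall b, base_algebra b -> crossed_mul a b = crossed_mul b a].

Definition properly_between (B : set (int -> CX)) : Prop :=
  [/\ is_subalgebra crossed_mul B, base_algebra `<` B & B `<` commutant].

Definition intersection_property (B : set (int -> CX)) : Prop :=
  forall I, is_two_sided_ideal crossed_mul crossed_product I ->
    ~ (I `<=` [set 0]) -> ~ (B `&` I `<=` [set 0]).

End CrossedProduct.

Definition exactly_one (P Q S : Prop) : Prop :=
  [/\ P \/ Q \/ S, ~ (P /\ Q), ~ (P /\ S) & ~ (Q /\ S)].

(* Main.v *)
Require Import Defs.
From HB Require Import structures.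
From mathcomp Require Import all_boot all_order all_algebra.
From mathcomp Require Import complex zify.
From mathcomp Require Import all_classical all_reals all_analysis.

Set Implicit Arguments.
Unset Strict Implicit.
Unset Printing Implicit Defensive.

Import Order.TTheory GRing.Theory Num.Theory.
Import numFieldNormedType.Exports.
Local Open Scope classical_set_scope.
Local Open Scope ring_scope.

(** Since [A] separates points, an element [a] of the crossed product commutes with
    [A] exactly when each coefficient [a n] is supported in the set of points fixed
    by the n-th power of the homeomorphism ([commutantP]).  The commutant is
    therefore an algebra of families of Laurent polynomials over the points of [X].

    If the nonperiodic points are dense, the open support of [a n] is empty for
    [n != 0], so the commutant is [A].  Otherwise the Baire property yields a period
    [n > 0] and a nonempty open set [V] of points with that period
    ([not_dense_fixed]), and a bump function on [V] times the n-th power of the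
    generator lies in the commutant but not in [A].

    Suppose moreover that [X] is infinite, so that it has no isolated points.
    The elements of the commutant that are constant over the points of a set [S]
    form a subalgebra, [flat_on S].
    - For [S] a point of [V] it has the intersection property ([flat_point_ip]),
      because the commutant has it ([commutant_ip], by a minimal support argument)
      and a nonzero element of an ideal can be cut off near the point without
      killing it.
    - For [S] a small invariant open set [O] of points of period [n] it has not:
      over [O] one can reduce the exponents modulo [n], and the kernel of this
      reduction, supported in [O], is a nonzero ideal ([residue_ideal]) that
      contains no nonzero element constant over [O].

    A finite connected Hausdorff space that is not empty is a point.  There the
    crossed product is the algebra of complex Laurent polynomials.  If a
    subalgebra contains the constants and a nonconstant [b], and if [c] is a
    nonzero element of an ideal, then the product of the [b - b(z)], for [z]
    among the nonzero roots of [c] with multiplicity, is a nonzero element of the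
    subalgebra and a multiple of [c] ([one_point_ip]).  So every intermediate
    subalgebra has the intersection property. *)

(** * Integer powers of a bijection *)

Section IntegerIterates.
Context {T : Type} {f g : T -> T} (fK : cancel f g) (gK : cancel g f).

Lemma iterzS n x : iterz f g (n + 1) x = f (iterz f g n x).
Proof.
case: n => [m|[|m]]; first by rewrite -PoszD addn1.
  by rewrite /= gK.
have -> : Negz m.+1 + 1 = Negz m by rewrite !NegzE (intS m.+1) opprD addrC addNKr.
by rewrite /= gK.
Qed.

Lemma iterzP n x : iterz f g (n - 1) x = g (iterz f g n x).
Proof. by rewrite -[in RHS](subrK 1 n) iterzS fK. Qed.

Lemma iterzD m n x : iterz f g (m + n) x = iterz f g m (iterz f g n x).
Proof.
elim/int_rect: m => [|m IH|m IH]; first by rewrite add0r.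
  by rewrite intS [1 + _]addrC addrAC !iterzS IH.
by rewrite intS opprD [- 1 - _]addrC addrAC !iterzP IH.
Qed.

Lemma iterz_fixN n x : iterz f g n x = x -> iterz f g (- n) x = x.
Proof. by move=> e; rewrite -{1}e -iterzD addNr. Qed.

Lemma iterz_opp n x : iterz f g (- n) x = iterz g f n x.
Proof. by case: n => [[|m]|m]. Qed.

Lemma iterz_fixM n x k : iterz f g n x = x -> iterz f g (k * n) x = x.
Proof.
move=> e; elim/int_rect: k => [|m IH|m IH]; first by rewrite mul0r.
  by rewrite intS mulrDl mul1r iterzD IH e.
by rewrite intS opprD mulrDl mulN1r iterzD IH iterz_fixN.
Qed.

End IntegerIterates.

(** * Pointwise formulas for the product *)

Section Products.
Context {R : realType} {X : Type} (sigma sigma' : X -> X).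
Local Notation C := R[i]^o.
Local Notation CX := (X -> C).
Local Notation act := (iterz sigma' sigma).
Local Notation "a ** b" := (crossed_mul sigma sigma' a b) (at level 40).
Implicit Types (a b : int -> CX) (f : CX).

Lemma iterz_sigma_tilde k f x :
  iterz (sigma_tilde sigma') (sigma_tilde_inv sigma) k f x = f (act k x).
Proof.
have E (h : X -> X) m y : iter m (fun f : CX => f \o h) f y = f (iter m h y).
  by elim: m y => //= m IH y; rewrite IH -iterSr.
by case: k => m /=; [exact: E|exact: (E sigma m.+1)].
Qed.

(** Evaluating a coefficient of the product at a point turns the twisted product
    into a finite scalar sum.  Every later computation goes through this formula,
    in which [act k] is the k-th power of the inverse homeomorphism. *)
Lemma crossed_mulE a b n x (s : seq int) : uniq s ->
    (forall k, k \notin s -> a k = 0 \/ b (n - k) = 0) ->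
  (a ** b) n x = \sum_(k <- s) a k x * b (n - k) (act k x).
Proof.
move=> us hs; rewrite /crossed_mul (fsbigE s)//; last first.
  move=> k _ /hs[->|b0]; first by rewrite mul0r.
  apply/funext => y.
  by rewrite -[LHS]/(a k y * _) iterz_sigma_tilde b0 mulr0.
under eq_bigl do rewrite in_setT.
rewrite fct_sumE; apply: eq_bigr => k _.
by rewrite -[LHS]/(a k x * _) iterz_sigma_tilde.
Qed.

Definition monomial n f : int -> CX := fun k => if k == n then f else 0.

Lemma mul_monomial n f b k x : (monomial n f ** b) k x = f x * b (k - n) (act n x).
Proof.
rewrite (@crossed_mulE _ _ _ _ [:: n])// ?big_seq1 /monomial ?eqxx// => j.
by rewrite inE => /negPf ->; left.
Qed.

Lemma monomial_mul a n f k x :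
  (a ** monomial n f) k x = a (k - n) x * f (act (k - n) x).
Proof.
rewrite (@crossed_mulE _ _ _ _ [:: k - n])// ?big_seq1 /monomial.
  by rewrite opprB addrCA subrr addr0 eqxx.
move=> j; rewrite inE => jkn; right.
by rewrite subr_eq addrC -subr_eq eq_sym (negPf jkn).
Qed.

Lemma delta0_mul f b k x : (delta0 f ** b) k x = f x * b k x.
Proof. by rewrite (mul_monomial 0) subr0. Qed.

Lemma mul_delta0 a f k x : (a ** delta0 f) k x = a k x * f (act k x).
Proof. by rewrite (monomial_mul _ 0) subr0. Qed.

End Products.

(** * Submodules, finite support and closure properties of the crossed product *)

Lemma submod_setP {K : pzRingType} {V : lmodType K} (B : set V) :
  GRing.submod_closed [in B] <->
  B 0 /\ (forall (c : K) u v, B u -> B v -> B (c *: u + v)).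
Proof.
split=> [[B0 Blin]|[B0 Blin]]; split.
- by move: B0; rewrite inE.
- move=> c u v Bu Bv.
  by have := Blin c u v; rewrite !inE => /(_ Bu Bv).
- by rewrite inE.
- by move=> c u v; rewrite !inE; exact: Blin.
Qed.

Section Subspace.
Context {K : pzRingType} {V : lmodType K} {B : set V}.
Hypothesis B_submod : GRing.submod_closed [in B].

Lemma submod0 : B 0. Proof. exact: (proj1 ((submod_setP B).1 B_submod)). Qed.
Lemma submod_lin c u v : B u -> B v -> B (c *: u + v).
Proof. exact: (proj2 ((submod_setP B).1 B_submod)). Qed.
Lemma submodD u v : B u -> B v -> B (u + v).
Proof. by rewrite -[u in B (u + _)]scale1r; exact: submod_lin. Qed.
Lemma submodZ c u : B u -> B (c *: u).
Proof.
by move=> Bu; rewrite -[_ *: _]addr0; apply: submod_lin => //; exact: submod0.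
Qed.
Lemma submodB u v : B u -> B v -> B (u - v).
Proof. by move=> Bu Bv; rewrite addrC -scaleN1r; exact: submod_lin. Qed.
Lemma submod_sum (I : Type) (s : seq I) (F : I -> V) :
  (forall i, B (F i)) -> B (\sum_(i <- s) F i).
Proof. by move=> BF; elim/big_ind: _ => //; [exact: submod0|exact: submodD]. Qed.
End Subspace.

Section Support.
Context {R : realType} {X : Type} (A : set (X -> R[i]^o)).
Local Notation CX := (X -> R[i]^o).

Lemma finite_suppP (a : int -> CX) :
  finite_set [set n | a n != 0] <->
  exists2 s : seq int, uniq s & forall k, k \notin s -> a k = 0.
Proof.
split=> [/finite_seqP[s As]|[s _ As]].
  exists (undup s); rewrite ?undup_uniq// => k; rewrite mem_undup => ks.
  apply/eqP; apply: contraNT ks => ak.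
  by have : [set n | a n != 0] k by []; rewrite As.
apply: (sub_finite_set (B := [set` s])) => // k /= ak.
by apply: contraNT ak => /As ->.
Qed.

Lemma crossed_supp {a} : crossed_product A a ->
  exists2 s : seq int, uniq s & forall k, k \notin s -> a k = 0.
Proof. by case=> _ /finite_suppP. Qed.

End Support.

Section CrossedAlgebra.
Context {R : realType} {X : Type} (sigma sigma' : X -> X) (A : set (X -> R[i]^o)).
Hypothesis A_subalgebra : is_subalgebra (fun f g : X -> R[i]^o => f * g) A.
Hypothesis A_invariant : forall f, A f -> A (sigma_tilde sigma' f).
Hypothesis A_invariant_inv : forall f, A f -> A (sigma_tilde_inv sigma f).
Local Notation C := R[i]^o.
Local Notation CX := (X -> C).
Local Notation act := (iterz sigma' sigma).
Local Notation "a ** b" := (crossed_mul sigma sigma' a b) (at level 40).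
Local Notation CP := (crossed_product A).
Implicit Types (a b : int -> CX) (f : CX).

Lemma crossed_product_submod : GRing.submod_closed [in CP].
Proof.
have [A_submod _] := A_subalgebra.
apply/submod_setP; split.
  split=> [n|]; first exact: (submod0 A_submod).
  by apply/finite_suppP; exists [::].
move=> c a b [Aa fa] [Ab fb] /=; split=> [n|].
  exact: (submod_lin A_submod c (Aa n) (Ab n)).
apply: (@sub_finite_set _ _ ([set n | a n != 0] `|` [set n | b n != 0])).
  move=> n /= abn; apply/orP; apply: contraNT abn.
  rewrite negb_or !negbK => /andP[/eqP an /eqP bn].
  by rewrite -[_ n]/(c *: a n + b n) an bn scaler0 addr0.
by rewrite finite_setU.
Qed.

Lemma crossed_product_monomial n f : A f -> CP (monomial n f).
Proof.
have [A_submod _] := A_subalgebra.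
move=> Af; split=> [k|].
  by rewrite /monomial; case: ifP => // _; exact: (submod0 A_submod).
apply/finite_suppP; exists [:: n] => // k.
by rewrite inE /monomial => /negPf ->.
Qed.

Lemma A_act k f : A f -> A (fun x => f (act k x)).
Proof.
have A_iter (h : X -> X) (Ah : forall g : CX, A g -> A (g \o h)) m g :
    A g -> A (fun x => g (iter m h x)).
  elim: m g => // m IH g Ag.
  have -> : (fun x => g (iter m.+1 h x)) = (fun x => g (iter m h x)) \o h.
    by apply/funext => x; rewrite iterSr.
  by apply: Ah; exact: IH.
by case: k => m; [exact: A_iter|exact: (A_iter sigma)].
Qed.

Lemma crossed_product_mul a b : CP a -> CP b -> CP (a ** b).
Proof.
have [A_submod AM] := A_subalgebra.
move=> CPa CPb; have [s us As] := crossed_supp CPa.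
have [t ut Bt] := crossed_supp CPb.
have abE n : (a ** b) n = \sum_(k <- s) a k * (fun x => b (n - k) (act k x)).
  apply/funext => x; rewrite fct_sumE (@crossed_mulE _ _ _ _ _ _ _ _ s)// => k ks.
  by left; exact: As.
split=> [n|].
  rewrite abE; apply: (submod_sum A_submod) => k.
  by apply: AM; [exact: CPa.1|apply: A_act; exact: CPb.1].
apply/finite_suppP; exists (undup [seq k + l | k <- s, l <- t]).
  exact: undup_uniq.
move=> n; rewrite mem_undup => nst; rewrite abE big_seq big1// => k ks.
rewrite Bt; first by apply/funext => x; exact: mulr0.
apply: contraNN nst => nkt; apply/allpairsP; exists (k, n - k).
by split=> //=; rewrite addrCA subrr addr0.
Qed.

End CrossedAlgebra.

(** * Open sets of a connected Hausdorff space *)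

Lemma continuous_iter (X : topologicalType) (h : X -> X) m :
  continuous h -> continuous (iter m h).
Proof.
move=> hc; elim: m => [|m IH] z; first exact: cvg_id.
by apply: continuous_comp; [exact: IH|exact: hc].
Qed.

Section Topology.
Context {X : topologicalType} (X_Hausdorff : hausdorff_space X).

Lemma closed_point (x : X) : closed [set x].
Proof. by apply: accessible_closed_set1; exact: hausdorff_accessible. Qed.

Lemma open_neq_continuous (U : topologicalType) (f g : U -> X) :
  continuous f -> continuous g -> open [set x | f x != g x].
Proof.
move=> fc gc; rewrite openE => x /= fgx.
move: X_Hausdorff; rewrite open_hausdorff => /(_ _ _ fgx)[[P Q]] /=.
rewrite !inE => -[Pf Qg] [oP oQ PQ].
have nP : \forall y \near x, P (f y) by apply: fc; exact: open_nbhs_nbhs.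
have nQ : \forall y \near x, Q (g y) by apply: gc; exact: open_nbhs_nbhs.
rewrite /interior /=; near=> y => /=.
apply/negP => /eqP fgy; suff : (P `&` Q) (f y) by rewrite PQ.
by split; [near: y|rewrite fgy; near: y].
Unshelve. all: by end_near. Qed.

Section Connected.
Hypothesis X_connected : connected [set: X].

(** An isolated point of a connected space in which points are closed is the whole
    space.  Hence an infinite connected Hausdorff space has no isolated point, and
    deleting finitely many points from a nonempty open set leaves a nonempty open
    set. *)
Lemma open_point_full (x : X) : open [set x] -> [set: X] = [set x].
Proof.
move=> ox; apply/esym; apply: X_connected; first by exists x.
  by exists [set x]; rewrite ?setTI.
by exists [set x]; rewrite ?setTI//; exact: closed_point.
Qed.

Lemma finite_connected_point (x : X) : finite_set [set: X] -> [set: X] = [set x].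
Proof.
move=> finX; apply: open_point_full; rewrite -[[set x]]setCK; apply: closed_openC.
move: (hausdorff_accessible X_Hausdorff) => /accessible_finite_set_closed; apply.
exact: sub_finite_set finX.
Qed.

Lemma open_minus_point (V : set X) (x : X) : infinite_set [set: X] ->
  open V -> V !=set0 -> open (V `\ x) /\ V `\ x !=set0.
Proof.
move=> infX oV V0; have oVx : open (V `\ x).
  by apply: openI => //; apply: closed_openC; exact: closed_point.
split => //; apply: contrapT => Vx0; apply: infX.
have VE : V = [set x].
  apply/seteqP; split=> [y Vy|_ ->].
    by apply: contrapT => yx; apply: Vx0; exists y.
  case: V0 => y Vy; apply: contrapT => Vx; apply: Vx0; exists y; split=> // yx.
  by apply: Vx; rewrite -yx.
by rewrite (@open_point_full x) -?VE// VE; exact: finite_set1.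
Qed.

Lemma open_minus_seq (V : set X) (s : seq X) : infinite_set [set: X] ->
  open V -> V !=set0 -> exists2 y, V y & y \notin s.
Proof.
move=> infX; elim: s V => [|x s IH] V oV V0; first by case: V0 => y Vy; exists y.
have [oVx /(IH _ oVx)[y [Vy yx] ys]] := open_minus_point x infX oV V0.
by exists y => //; rewrite inE negb_or ys andbT; apply/eqP.
Qed.

End Connected.

(** Separates a point [y] from a finite piece of the orbit of [x], uniformly over
    neighbourhoods of [x] and [y]; the neighbourhoods come from intersecting, over
    the exponents [k], those that separate the k-th iterate of [x] from [y]. *)
Lemma separate_iterates (h : X -> X) (x y : X) m : continuous h ->
  (forall k, (k < m)%N -> iter k h x <> y) ->
  exists N M : set X, [/\ open N, N x, open M, M y &
    forall k p q, (k < m)%N -> N p -> M q -> iter k h p <> q].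
Proof.
move=> hc; elim: m => [|m IH] hxy.
  by exists setT, setT; split=> //; exact: openT.
have [k km|N [M [oN Nx oM My NM]]] := IH; first by apply: hxy; exact: ltnW.
have hm : continuous (iter m h) by exact: continuous_iter.
have /eqP := hxy m (ltnSn m).
move: X_Hausdorff; rewrite open_hausdorff => H /H[[P Q]] /=.
rewrite !inE => -[Px Qy] [oP oQ PQ].
exists (N `&` (iter m h @^-1` P)), (M `&` Q); split => //.
- by apply: openI => //; apply: open_comp => // z _; exact: hm.
- exact: openI.
- move=> k p q; rewrite ltnS leq_eqVlt => /orP[/eqP ->|km] [Np Pp] [Mq Qq].
    move=> e; suff : (P `&` Q) q by rewrite PQ.
    by split=> //; rewrite -e.
  exact: NM.
Qed.

End Topology.

Lemma open_support (R : realType) (X : topologicalType) (f : X -> R[i]^o) :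
  continuous f -> open [set x | f x != 0].
Proof.
by move=> fc; apply: (open_neq_continuous (@norm_hausdorff _ _)) => //; exact: cst_continuous.
Qed.

(** * The commutant *)

Section Commutant.
Context {R : realType} {X : topologicalType} (X_Hausdorff : hausdorff_space X).
Context (X_connected : connected [set: X]) (X_Baire : Baire_space X).
Context (sigma sigma' : X -> X).
Context (sigma_homeo : homeomorphism_with_inverse sigma sigma').
Context (A : set (X -> R[i]^o)).
Context (A_continuous : forall f, A f -> continuous f).
Context (A_subalgebra : is_subalgebra (fun f g : X -> R[i]^o => f * g) A).
Context (A_invariant : forall f, A f -> A (sigma_tilde sigma' f)).
Context (A_invariant_inv : forall f, A f -> A (sigma_tilde_inv sigma f)).
Context (A_separates : forall (U : set X) (x : X), open U -> U x ->
       exists f, [/\ A f, f x != 0 & [set y | f y != 0] `<=` U]).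
Local Notation C := R[i]^o.
Local Notation CX := (X -> C).
Local Notation act := (iterz sigma' sigma).
Local Notation "a ** b" := (crossed_mul sigma sigma' a b) (at level 40).
Local Notation CP := (crossed_product A).
Local Notation A0 := (base_algebra A).
Local Notation A' := (commutant sigma sigma' A).
Implicit Types (a b : int -> CX) (f : CX).

Let sK : cancel sigma sigma'. Proof. by case: sigma_homeo. Qed.
Let s'K : cancel sigma' sigma. Proof. by case: sigma_homeo. Qed.

Definition fixed_by (n : int) : set X := [set x | act n x = x].

Lemma fixed_byD m n x : fixed_by m x -> fixed_by n x -> fixed_by (m + n) x.
Proof. by rewrite /fixed_by /= iterzD// => + -> => ->. Qed.

(** The complement of {y} is an open neighbourhood of [x], so a bump function at [x]
    serves. *)
Lemma separating_function x y : x != y -> exists f, [/\ A f, f x != 0 & f y = 0].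
Proof.
move=> xy; have oy : open (~` [set y]).
  apply: closed_openC; apply: accessible_closed_set1.
  exact: hausdorff_accessible.
have [|f [Af fx fy]] := A_separates oy (x := x); first by apply/eqP.
exists f; split => //; apply/eqP; apply: contrapT => /negP /fy; exact.
Qed.

(** Comparing the k-th coefficients of [a f] and [f a] at [x] gives
    [a k x * (f (act k x) - f x) = 0] for all [f] in [A].  As [A] separates points,
    this forces [act k x = x] wherever [a k] does not vanish.  So the commutant is
    fibrewise untwisted: its elements are families of Laurent polynomials. *)
Lemma commutantP a :
  A' a <-> CP a /\ forall k x, a k x != 0 -> fixed_by k x.
Proof.
split=> [[CPa comm]|[CPa fixed]]; split=> //.
  move=> k x akx; apply: contrapT => /eqP/separating_function[f [Af fx fy]].
  have /(congr1 (fun c => c k x))/eqP := comm _ (ex_intro2 _ _ f Af erefl).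
  by rewrite delta0_mul mul_delta0 fy mul0r mulf_eq0 (negPf akx) (negPf fx).
move=> _ [f Af <-]; apply/funext => k; apply/funext => x.
rewrite delta0_mul mul_delta0 mulrC.
have [->|/fixed ->//] := eqVneq (a k x) 0; by rewrite !mulr0.
Qed.

(** Over each point of [S] the Laurent polynomial attached to [a] is constant.  All
    the intermediate subalgebras that are needed have this form: [S] is a single
    point for one with the intersection property, and a thin invariant open set
    for one without it. *)
Definition flat_on (S : set X) : set (int -> CX) :=
  [set a | A' a /\ forall k x, k != 0 -> S x -> a k x = 0].

Lemma flat_on_subalgebra S : is_subalgebra (crossed_mul sigma sigma') (flat_on S).
Proof.
split.
  have CP_submod := crossed_product_submod A_subalgebra.
  apply/submod_setP; split.
    split=> //; apply/commutantP; split; first exact: (submod0 CP_submod).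
    by move=> k x; rewrite eqxx.
  move=> c a b [/commutantP[CPa fa] Sa] [/commutantP[CPb fb] Sb].
  split; last first.
    move=> k x k0 Sx; rewrite -[LHS]/(c * a k x + b k x).
    by rewrite Sa// Sb// mulr0 addr0.
  apply/commutantP; split; first exact: (submod_lin CP_submod).
  move=> k x; rewrite -[_ k x]/(c * a k x + b k x).
  have [->|/fa//] := eqVneq (a k x) 0.
  have [->|/fb//] := eqVneq (b k x) 0.
  by rewrite mulr0 addr0 eqxx.
move=> a b [/commutantP[CPa fa] Sa] [/commutantP[CPb fb] Sb].
have [s us As] := crossed_supp CPa.
have abE n x : (a ** b) n x = \sum_(k <- s) a k x * b (n - k) (act k x).
  by apply: crossed_mulE => // k /As; left.
split; last first.
  move=> n x n0 Sx; rewrite abE big1// => k _.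
  have [->|k0] := eqVneq k 0; first by rewrite subr0 /= Sb// mulr0.
  by rewrite Sa// mul0r.
apply/commutantP; split; first exact: crossed_product_mul.
move=> n x; rewrite abE => abn; apply: contrapT => nfix.
move/eqP: abn; apply; apply: big1 => k _; apply/eqP; apply: contra_notT nfix.
rewrite mulf_eq0 negb_or => /andP[/fa akx]; rewrite akx => /fb bkx.
by rewrite -(subrK k n); exact: fixed_byD.
Qed.

Lemma base_sub_flat S : A0 `<=` flat_on S.
Proof.
move=> _ [f Af <-]; have f0 k x : k != 0 -> delta0 f k x = 0.
  by rewrite /delta0 => /negPf ->.
split=> [|k x k0 _]; last exact: f0.
apply/commutantP; split; first exact: (crossed_product_monomial A_subalgebra 0).
move=> k x; by have [->//|/f0 ->] := eqVneq k 0; rewrite ?eqxx.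
Qed.

Lemma base_sub_commutant : A0 `<=` A'.
Proof. by move=> a /(@base_sub_flat set0) []. Qed.

Lemma monomial_commutant n f : A f -> [set x | f x != 0] `<=` fixed_by n ->
  A' (monomial n f).
Proof.
move=> Af fn; apply/commutantP; split; first exact: crossed_product_monomial.
move=> k x; rewrite /monomial; have [->|_] := eqVneq k n; first exact: fn.
by rewrite eqxx.
Qed.

(** In a nonzero ideal take [c] with as few nonzero coefficients as possible and
    shift it, by multiplying with a monomial, so that [c 0] is nonzero.  For [g] in
    [A] the commutator of [c] with [g] lies in the ideal and its coefficient at 0
    vanishes, so it has smaller support and must be 0: [c] is in the commutant.
    The proof runs this argument as an induction on a bound [m] for the size of
    the support. *)
Lemma commutant_ip : intersection_property sigma sigma' A A'.
Proof.
move=> I [I_CP I_submod I_ideal] I_neq0.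
suff main m c s : (size s <= m)%N -> (forall k, k \notin s -> c k = 0) ->
    I c -> c <> 0 -> exists c', [/\ I c', c' <> 0 & A' c'].
  have [c [Ic c0]] : exists c, I c /\ c <> 0.
    apply: contrapT => /forallNP H; apply: I_neq0 => c Ic /=.
    by apply: contrapT => c0; exact: (H c).
  have [s _ cs] := crossed_supp (I_CP _ Ic).
  have [d [Id d0 dA]] := main _ _ _ (leqnn (size s)) cs Ic c0.
  by move=> /(_ d); apply: (fun h P => h (P _)) => //; exact: d0.
elim: m c s => [|m IH] c s.
  rewrite leqn0 => /nilP -> cs _; case; apply/funext => k; exact: cs.
move=> sm cs Ic c0.
have [n [x cnx]] : exists n x, c n x != 0.
  apply: contrapT => /forallNP H; apply: c0; apply/funext => n.
  apply/funext => x; apply/eqP; apply: contrapT => /negP cnx.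
  by apply: (H n); exists x.
have [f [Af fx _]] := A_separates openT (x := act n x) Logic.I.
pose d := c ** monomial (- n) f.
have Id : I d.
  by have [_] := I_ideal _ c (crossed_product_monomial A_subalgebra (- n) Af) Ic.
have dE k y : d k y = c (k + n) y * f (act (k + n) y).
  by rewrite /d monomial_mul opprK.
have d0 : d <> 0.
  move/(congr1 (fun a => a 0 x))/eqP; rewrite dE add0r mulf_eq0.
  by rewrite (negPf cnx) (negPf fx).
have [dA'|] := pselect (A' d); first by exists d.
move=> /not_andP[/(_ (I_CP _ Id))//|/existsNP[_ /not_implyP[[g Ag <-] ndg]]].
pose e := d ** delta0 g - delta0 g ** d.
have eE k y : e k y = d k y * g (act k y) - g y * d k y.
  by rewrite -[LHS]/((d ** delta0 g) k y - (delta0 g ** d) k y) delta0_mul mul_delta0.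
have [J1 J2] := I_ideal _ _ (crossed_product_monomial A_subalgebra 0 Ag) Id.
pose t := [seq k - n | k <- s].
apply: (IH e [seq k <- t | k != 0]).
- rewrite -ltnS; apply: leq_trans sm.
  rewrite size_filter -(size_map (fun k => k - n) s) -(count_predC (pred1 0)).
  rewrite -[ltnLHS]add0n ltn_add2r -has_count; apply/hasP; exists 0 => //.
  apply/mapP; exists n; last by rewrite subrr.
  by apply: contraNT cnx => /cs ->.
- move=> k; rewrite mem_filter /= negb_and negbK => /orP[/eqP ->|kt].
    by apply/funext => y; rewrite eE /= mulrC subrr.
  apply/funext => y; rewrite eE dE cs ?mul0r ?mulr0 ?subr0//.
  by apply: contraNN kt => kns; apply/mapP; exists (k + n); rewrite ?addrK.
- exact: (submodB I_submod).
- by move=> /eqP; rewrite subr_eq0 => /eqP.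
Qed.

(** * Nonperiodic points and equality of the algebra with its commutant *)

Lemma continuous_act n : continuous (act n).
Proof.
by case: sigma_homeo => _ _ sc s'c; case: n => m; exact: continuous_iter.
Qed.

Lemma closed_fixed_by n : closed (fixed_by n).
Proof.
rewrite -[fixed_by n]setCK; apply: open_closedC.
have -> : ~` fixed_by n = [set x | act n x != x].
  by apply/seteqP; split=> x /= /eqP.
apply: (open_neq_continuous X_Hausdorff (g := id)); first exact: continuous_act.
by move=> x; exact: cvg_id.
Qed.

Lemma nonperiodicP x :
  nonperiodic sigma sigma' x <-> forall m : nat, ~ fixed_by m.+1 x.
Proof.
split=> [np m fx|np n n0].
  apply: (np (- m.+1%:Z)); first by rewrite oppr_eq0.
  by rewrite iterz_opp.
rewrite -iterz_opp => fx; case: n n0 fx => [[//|m]|m] _ fx; last exact: (np m).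
by apply: (np m); rewrite /fixed_by /mkset -[m.+1%:Z]opprK; exact: iterz_fixN.
Qed.

(** This is the use of the Baire property: the nonperiodic points are the
    intersection of the open complements of the closed sets [fixed_by m.+1], so if
    they are not dense, one of these complements misses a nonempty open set. *)
Lemma not_dense_fixed : ~ dense (nonperiodic sigma sigma') ->
  exists m (V : set X), [/\ open V, V !=set0 & V `<=` fixed_by (m.+1)].
Proof.
move=> nd; apply: contrapT => /forallNP H; apply: nd.
have -> : nonperiodic sigma sigma' = \bigcap_m (~` fixed_by (m : nat).+1).
  apply/seteqP; split=> [x /nonperiodicP np m _|x np]; first exact: np.
  by apply/nonperiodicP => m; exact: np.
apply: X_Baire => m; split; first exact/closed_openC/closed_fixed_by.
move=> V V0 oV; apply: contrapT => Vm; apply: (H m); exists V; split => // x Vx.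
by apply: contrapT => nx; apply: Vm; exists x.
Qed.

(** A coefficient [a n] with [n != 0] of an element of the commutant has open support
    made of periodic points; this support misses a dense set, so it is empty. *)
Lemma dense_commutant : dense (nonperiodic sigma sigma') -> A' `<=` A0.
Proof.
move=> dP a /commutantP[[Aa _] fa].
exists (a 0) => //; apply/funext => n; rewrite /delta0.
have [->//|n0] := eqVneq n 0; apply/funext => x; apply/esym/eqP.
apply: contrapT => /negP anx.
have [||y [/= any /nonperiodicP np]] := dP [set y | a n y != 0].
- by exists x.
- exact/open_support/A_continuous.
have := fa _ _ any; case: n n0 {anx any} => [[//|m]|m] _; first exact: np.
by move/(iterz_fixN s'K sK); exact: np.
Qed.

Lemma monomial_not_base n f x : n != 0 -> f x != 0 -> ~ A0 (monomial n f).
Proof.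
move=> n0 fx [g _ /(congr1 (fun c => c n x))/eqP].
by rewrite /delta0 /monomial eqxx (negPf n0) eq_sym (negPf fx).
Qed.

Lemma fixed_not_base n V : n != 0 -> open V -> V !=set0 -> V `<=` fixed_by n ->
  ~ (A' `<=` A0).
Proof.
move=> n0 oV [x Vx] Vn A'A0; have [f [Af fx fV]] := A_separates oV Vx.
apply: (monomial_not_base n0 fx); apply: A'A0.
apply: monomial_commutant => //; exact: subset_trans Vn.
Qed.

Lemma dense_base_eq : A0 = A' <-> dense (nonperiodic sigma sigma').
Proof.
split=> [e|dP]; last first.
  apply/seteqP; split; first exact: base_sub_commutant.
  exact: dense_commutant.
apply: contrapT => /not_dense_fixed[m [V [oV V0 Vm]]].
by apply: (@fixed_not_base m.+1 V) => //; rewrite e.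
Qed.

(** * Subalgebras between the algebra and its commutant *)

Lemma flat_between n (V S : set X) : n != 0 -> open V -> V `<=` fixed_by n ->
    V `&` S !=set0 -> (exists U, [/\ open U, U !=set0, U `<=` V & U `&` S = set0]) ->
  properly_between sigma sigma' A (flat_on S).
Proof.
move=> n0 oV Vn [x [Vx Sx]] [U [oU [y Uy] UV US]]; split.
- exact: flat_on_subalgebra.
- split; first exact: base_sub_flat.
  have [f [Af fy fU]] := A_separates oU Uy.
  move=> /(_ (monomial n f)) H; apply: (monomial_not_base n0 fy); apply: H.
  split; first by apply: monomial_commutant => // z /fU/UV/Vn.
  move=> k z k0 Sz; rewrite /monomial; case: ifP => // _.
  apply/eqP; apply: contrapT => /negP /fU Uz.
  by rewrite -[False]/(set0 z) -US.
- split; first by move=> a [].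
  have [f [Af fx fV]] := A_separates oV Vx.
  move=> /(_ (monomial n f)) []; first by apply: monomial_commutant => // z /fV/Vn.
  move=> _ /(_ n x n0 Sx)/eqP.
  by rewrite /monomial eqxx (negPf fx).
Qed.

(** A nonzero ideal contains a nonzero [c] of the commutant.  The support of a
    nonzero coefficient of [c] is open and [x0] is not isolated, so some [f] in [A]
    vanishes at [x0] but not everywhere on that support; [f c] is then a nonzero
    element of the ideal whose fibre at [x0] is 0. *)
Lemma flat_point_ip x0 : infinite_set [set: X] ->
  intersection_property sigma sigma' A (flat_on [set x0]).
Proof.
move=> infX I I_ideal I_neq0 flatI0.
have [I_CP I_submod I_mul] := I_ideal.
apply: (commutant_ip I_ideal I_neq0).
move=> c [A'c Ic]; apply/funext => n; apply/funext => x; apply/eqP.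
apply: contrapT => /negP cnx.
have oc : open [set y | c n y != 0] by apply/open_support/A_continuous/(I_CP _ Ic).1.
have [ocx0 [y [/= cny yx0]]] := open_minus_point X_Hausdorff X_connected x0 infX oc
  (ex_intro _ x cnx).
have [f [Af fy f0]] := A_separates ocx0 (conj cny yx0).
have fx0 : f x0 = 0 by apply/eqP; apply: contrapT => /negP /f0 [_ /(_ erefl)].
have /flatI0 : (flat_on [set x0] `&` I) (crossed_mul sigma sigma' (delta0 f) c).
  split; last by have [] := I_mul _ _ (crossed_product_monomial A_subalgebra 0 Af) Ic.
  move: A'c => /commutantP[CPc fc].
  split; last by move=> k _ k0 ->; rewrite delta0_mul fx0 mul0r.
  apply/commutantP; split.
    have := (crossed_product_mul A_subalgebra); apply => //.
    exact: (crossed_product_monomial A_subalgebra 0).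
  move=> k z; rewrite delta0_mul mulf_eq0 negb_or => /andP[_]; exact: fc.
move=> /(congr1 (fun a => a n y))/eqP; rewrite delta0_mul mulf_eq0.
by rewrite (negPf fy) (negPf cny).
Qed.

(** * An ideal that avoids a subalgebra *)

(** For [phi k = z ^ k] this is the value at [z] of the Laurent polynomial of [a]
    over [x].  Arbitrary weights are allowed because a product shifts them, and
    because the periodic ones detect sums of coefficients along residue classes. *)
Definition weight a (phi : int -> C) (x : X) : C :=
  \sum_(k \in [set: int]) a k x * phi k.

Lemma sum_supp (F : int -> C) (s : seq int) : uniq s ->
  (forall k, k \notin s -> F k = 0) -> \sum_(k \in [set: int]) F k = \sum_(k <- s) F k.
Proof.
move=> us Fs; rewrite (fsbigE s)// => [|k _ /Fs//].
by under eq_bigl do rewrite in_setT.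
Qed.

Lemma weightE a phi x s : uniq s -> (forall k, k \notin s -> a k x = 0) ->
  weight a phi x = \sum_(k <- s) a k x * phi k.
Proof. by move=> us as0; apply: sum_supp => // k /as0 ->; rewrite mul0r. Qed.

Lemma weight_mul a b phi x s t : uniq s -> uniq t ->
    (forall k, k \notin s -> a k = 0) -> (forall k, k \notin t -> b k = 0) ->
  weight (a ** b) phi x =
  \sum_(j <- s) \sum_(l <- t) a j x * b l (act j x) * phi (j + l).
Proof.
move=> us ut as0 bt0; pose u := undup [seq k + l | k <- s, l <- t].
have uu : uniq u by exact: undup_uniq.
have abE n : (a ** b) n x = \sum_(j <- s) a j x * b (n - j) (act j x).
  by apply: crossed_mulE => // k /as0; left.
have bu n j : j \in s -> n \notin u -> b (n - j) = 0.
  move=> js nu; apply: bt0; apply: contraNN nu => njt; rewrite mem_undup.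
  by apply/allpairsP; exists (j, n - j); split => //=; rewrite addrCA subrr addr0.
rewrite (weightE _ uu); last first.
  move=> n nu; rewrite abE big_seq big1// => j js.
  by rewrite bu//; exact: mulr0.
under eq_bigr => n _ do rewrite abE mulr_suml.
rewrite exchange_big big_seq [RHS]big_seq; apply: eq_bigr => j js.
have ujt : uniq [seq j + l | l <- t] by rewrite map_inj_uniq//; exact: addrI.
rewrite -(@sum_supp _ u)//; last first.
  by move=> n nu; rewrite bu// [0 _]/(0 : C) mulr0 mul0r.
rewrite (sum_supp ujt); last first.
  move=> n nt; rewrite bt0; first by rewrite [0 _]/(0 : C) mulr0 mul0r.
  by apply: contraNN nt => njt; apply/mapP; exists (n - j) => //; rewrite addrCA subrr addr0.
by rewrite big_map; apply: eq_bigr => l _; rewrite addrC addrA addNr add0r.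
Qed.

(** For an invariant [O] of points of period [m], reducing exponents modulo [m] maps
    the crossed product, restricted to [O], to a crossed product by the cyclic group
    of order [m].  The ideal consists of the elements of its kernel whose
    coefficients vanish off [O].  The kernel condition, that the coefficients sum to
    0 along each residue class modulo [m], is tested against all [m]-periodic
    weights, a form in which it is visibly stable under shifts. *)
Definition residue_ideal (m : int) (O : set X) : set (int -> CX) :=
  [set a | [/\ CP a, forall k x, ~ O x -> a k x = 0 &
    forall (phi : int -> C) x, (forall k, phi (k + m) = phi k) -> weight a phi x = 0]].

(** By [weight_mul], the weight of a product is an iterated sum.  For a left factor
    [p] the inner sum is a weight of [a] at a moved point for a shifted weight.  For a
    right factor the exponent [j] enters [p l (act j x) * phi (j + l)] periodically,
    since [act m] fixes [O], so the sum over [j] is a periodic weight of [a]. *)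
Lemma residue_idealP m O : (forall k x, O (act k x) -> O x) -> O `<=` fixed_by m ->
  is_two_sided_ideal (crossed_mul sigma sigma') CP (residue_ideal m O).
Proof.
move=> O_inv Om; split; first by move=> a [].
  have CP_submod := crossed_product_submod A_subalgebra.
  apply/submod_setP; split.
    split=> //; first exact: submod0.
    by move=> phi x _; rewrite (@weightE _ _ _ [::])// big_nil.
  move=> c a b [CPa aO aw] [CPb bO bw]; split; first exact: (submod_lin CP_submod).
    by move=> k x xO; rewrite -[LHS]/(c * a k x + b k x) aO// bO// mulr0 addr0.
  move=> phi x phim.
  have [s us as0] := crossed_supp CPa; have [t ut bt0] := crossed_supp CPb.
  pose u := undup (s ++ t).
  have uu : uniq u by exact: undup_uniq.
  have au k : k \notin u -> a k x = 0.
    by rewrite mem_undup mem_cat negb_or => /andP[/as0 ->].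
  have bu k : k \notin u -> b k x = 0.
    by rewrite mem_undup mem_cat negb_or => /andP[_ /bt0 ->].
  rewrite (weightE _ uu); last first.
    by move=> k ku; rewrite -[LHS]/(c * a k x + b k x) au// bu// mulr0 addr0.
  rewrite (eq_bigr (fun k => c * (a k x * phi k) + b k x * phi k)); last first.
    by move=> k _; rewrite -[(_ + _) k x]/(c * a k x + b k x) mulrDl mulrA.
  rewrite big_split -mulr_sumr -(weightE phi uu au) -(weightE phi uu bu).
  by rewrite (aw phi x phim) (bw phi x phim) mulr0 /= addr0.
move=> p a CPp [CPa aO aw].
have [s us as0] := crossed_supp CPa; have [t ut pt0] := crossed_supp CPp.
split; split.
- exact: crossed_product_mul.
- move=> k x xO; rewrite (@crossed_mulE _ _ _ _ _ _ _ _ t)=> // [|j /pt0]; last by left.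
  by apply: big1 => j _; rewrite aO ?mulr0// => /O_inv.
- move=> phi x phim; rewrite (weight_mul _ _ ut us pt0 as0) big1// => j _.
  under eq_bigr do rewrite -mulrA.
  rewrite -mulr_sumr -(@weightE a (fun l => phi (j + l)) _ s)//.
    by rewrite aw ?mulr0// => k; rewrite addrA.
  by move=> k /as0 ->.
- exact: crossed_product_mul.
- move=> k x xO; rewrite (@crossed_mulE _ _ _ _ _ _ _ _ s)=> // [|j /as0]; last by left.
  by apply: big1 => j _; rewrite aO ?mul0r.
- move=> phi x phim; rewrite (weight_mul _ _ us ut as0 pt0) exchange_big.
  apply: big1 => l _; have [Ox|nOx] := pselect (O x); last first.
    by apply: big1 => j _; rewrite aO// !mul0r.
  under eq_bigr do rewrite -mulrA.
  rewrite -(@weightE a (fun j => p l (act j x) * phi (j + l)) _ s)//.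
    by rewrite aw// => k; rewrite iterzD// Om// addrAC phim.
  by move=> k /as0 ->.
Qed.

(** Over a point of [O] only the coefficient at 0 survives, and the constant weight
    1, which is periodic, shows that it vanishes too. *)
Lemma flat_residue0 m O : flat_on O `&` residue_ideal m O `<=` [set 0].
Proof.
move=> a [[_ a0] [_ aO aw]]; apply/funext => k; apply/funext => x.
have [Ox|] := pselect (O x); last exact: aO.
have [->|k0] := eqVneq k 0; last exact: a0.
have := aw (fun=> 1) x (fun=> erefl).
rewrite (@weightE _ _ _ [:: 0])// ?big_seq1 ?mulr1// => j.
by rewrite inE => j0; exact: a0.
Qed.

Lemma flat_not_ip n O N x : n != 0 -> (forall k x, O (act k x) -> O x) ->
    O `<=` fixed_by n -> open N -> N x -> N `<=` O ->
  ~ intersection_property sigma sigma' A (flat_on O).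
Proof.
move=> n0 O_inv On oN Nx NO /(_ _ (residue_idealP O_inv On)) H.
apply: H; last exact: flat_residue0.
have [f [Af fx fN]] := A_separates oN Nx.
have CP_submod := crossed_product_submod A_subalgebra.
(* The exponents 0 and n are congruent modulo n, so a is in the kernel. *)
pose a := delta0 f - monomial n f.
have aE k y : a k y = (if k == 0 then f y else 0) - (if k == n then f y else 0).
  by rewrite -[LHS]/(delta0 f k y - monomial n f k y) /delta0 /monomial; do 2 case: ifP.
move=> I0; have /I0 : residue_ideal n O a.
  split.
  - apply: (submodB CP_submod); last exact: crossed_product_monomial.
    exact: (crossed_product_monomial A_subalgebra 0).
  - move=> k y yO; have fy : f y = 0.
      by apply/eqP; apply: contrapT => /negP /fN /NO.
    by rewrite aE fy !if_same subrr.
  - move=> phi y phin; have phin0 : phi n = phi 0 by rewrite -(phin 0) add0r.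
    rewrite (@weightE _ _ _ [:: 0; n]).
    + rewrite big_cons big_seq1 !aE !eqxx (negPf n0) eq_sym (negPf n0).
      by rewrite phin0 subr0 sub0r mulNr subrr.
    + by rewrite /= inE eq_sym n0.
    + by move=> k; rewrite !inE negb_or aE => /andP[/negPf -> /negPf ->]; rewrite subrr.
move=> /(congr1 (fun c => c 0 x))/eqP.
by rewrite aE eqxx [0 == n]eq_sym (negPf n0) subr0 (negPf fx).
Qed.

(** Inside an open set [V] of points of period [m.+1] choose [x] and [y] in distinct
    orbits, with neighbourhoods [N] and [M] such that no iterate of [N] meets [M].
    The saturation [O] of [N] is small enough for elements that are flat on [O] to be
    nontrivial over [M], and its residue ideal avoids them. *)
Lemma exists_not_ip : infinite_set [set: X] -> ~ dense (nonperiodic sigma sigma') ->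
  exists2 B, properly_between sigma sigma' A B & ~ intersection_property sigma sigma' A B.
Proof.
move=> infX /not_dense_fixed[m [V [oV [x Vx] Vm]]].
have [y Vy] := open_minus_seq X_Hausdorff X_connected
  [seq iter j sigma' x | j <- iota 0 m.+1] infX oV (ex_intro _ x Vx).
move=> yx.
have s'c : continuous sigma' by case: sigma_homeo.
have [|N [M [oN Nx oM My NM]]] := @separate_iterates _ X_Hausdorff _ x y m.+1 s'c.
  move=> k km xy; move/negP: yx; apply; apply/mapP; exists k => //.
  by rewrite mem_iota.
pose O := [set z | exists k, (N `&` V) (act k z)].
have O_inv k z : O (act k z) -> O z.
  by move=> [j]; rewrite -iterzD// => NVz; exists (j + k).
have NO : N `&` V `<=` O by move=> z NVz; exists 0.
have Om : O `<=` fixed_by m.+1.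
  move=> z [k [_ /Vm]]; rewrite /fixed_by /mkset -iterzD// addrC iterzD//.
  by move=> /(congr1 (act (- k))); rewrite -!iterzD// addNr.
exists (flat_on O); last first.
  exact: (@flat_not_ip m.+1 O (N `&` V) x _ O_inv Om (openI oN oV) (conj Nx Vx) NO).
apply: (@flat_between m.+1 V) => //; first by exists x; split=> //; exact: NO.
exists (M `&` V); split; [exact: openI|by exists y|by move=> z []|].
apply/seteqP; split=> // z [[Mz _] [k [Nz /Vm fz]]].
(* As act k z has period m.+1, the exponent leading back to z can be reduced
   modulo m.+1, into the range where N and M are known to be separated. *)
pose r := (- k %% m.+1%:Z)%Z.
have r0 : 0 <= r by exact: modz_ge0.
have rm : (`|r| < m.+1)%N by rewrite -ltz_nat gez0_abs// ltz_pmod.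
apply: (NM `|r|%N _ _ rm Nz Mz).
rewrite -[LHS]/(act `|r|%N (act k z)) gez0_abs//.
transitivity (act (- k) (act k z)); last by rewrite -iterzD// addNr.
have -> : - k = r + (- k %/ m.+1%:Z)%Z * m.+1%:Z by rewrite addrC -divz_eq.
by rewrite iterzD// (iterz_fixM s'K sK).
Qed.

Lemma exists_ip : infinite_set [set: X] -> ~ dense (nonperiodic sigma sigma') ->
  exists2 B, properly_between sigma sigma' A B & intersection_property sigma sigma' A B.
Proof.
move=> infX /not_dense_fixed[m [V [oV [x Vx] Vm]]].
exists (flat_on [set x]); last exact: flat_point_ip.
apply: (@flat_between m.+1 V) => //; first by exists x.
have [oVx Vx0] := open_minus_point X_Hausdorff X_connected x infX oV (ex_intro _ x Vx).
exists (V `\ x); split => //.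
by apply/seteqP; split=> // y [[_ yx] /yx].
Qed.

End Commutant.

(** * The one-point space: Laurent polynomials *)

Section LaurentCoefficients.
Context {K : comNzRingType}.
Implicit Types p q : {poly K}.

Definition coefz p (j : int) : K := if j is Posz i then p`_i else 0.

Lemma coefz_neg p j : j < 0 -> coefz p j = 0.
Proof. by case: j. Qed.

Lemma coefz_mul p q j :
  coefz (p * q) j = \sum_(0 <= i < size p) p`_i * coefz q (j - i%:Z).
Proof.
case: j => j; last first.
  by rewrite big1_seq// => i _; rewrite coefz_neg ?mulr0//; lia.
rewrite big_mkord /= -[p in p * q]coefK poly_def mulr_suml coef_sum.
apply: eq_bigr => i _; rewrite -scalerAl coefZ ['X^i * q]mulrC coefMXn; congr (_ * _).
case: ltnP => ji; last by rewrite subzn.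
by rewrite coefz_neg// subr_lt0 ltz_nat.
Qed.

Lemma coefz_mulXn p n j : coefz (p * 'X^n) (j + n%:Z) = coefz p j.
Proof.
rewrite mulrC coefz_mul size_polyXn big_nat_recr//= big_nat big1 => [|i /andP[_ i_n]].
  by rewrite coefXn eqxx mul1r add0r addrK.
by rewrite coefXn (ltn_eqF i_n) mul0r.
Qed.

End LaurentCoefficients.

Section OnePoint.
Context {R : realType} {X : Type} (x0 : X) (X_point : forall x, x = x0).
Context (sigma sigma' : X -> X) (A : set (X -> R[i]^o)).
Context (A_subalgebra : is_subalgebra (fun f g : X -> R[i]^o => f * g) A).
Context (A_nonzero : exists2 f, A f & f x0 != 0).
Local Notation C := R[i].
Local Notation CX := (X -> R[i]^o).
Local Notation "a ** b" := (crossed_mul sigma sigma' a b) (at level 40).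
Local Notation CP := (crossed_product A).
Implicit Types (a b : int -> CX) (f : CX) (p q : {poly C}).

Lemma one_point_full f : A f.
Proof.
have [g Ag gx] := A_nonzero; have [A_submod _] := A_subalgebra.
have -> : f = (f x0 / g x0 : C) *: g; last exact: (submodZ A_submod).
by apply/funext => x; rewrite (X_point x) -[RHS]/(f x0 / g x0 * g x0) divfK.
Qed.

(** [laurent m p] is the Laurent polynomial p / 'X^m.  The exponent [m] is an integer
    so that quotients by powers of 'X are again of this form. *)
Definition laurent (m : int) p : int -> CX := fun k _ => coefz p (k + m).

Lemma laurent_supp m p k :
  k \notin [seq i%:Z - m | i <- iota 0 (size p)] -> coefz p (k + m) = 0.
Proof.
case km: (k + m) => [j|//] kp /=; apply: nth_default.
rewrite leqNgt; apply: contraNN kp => jp; apply/mapP; exists j.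
  by rewrite mem_iota.
by rewrite -km addrK.
Qed.

Lemma laurent_crossed m p : CP (laurent m p).
Proof.
split=> [k|]; first exact: one_point_full.
apply/finite_suppP; exists (undup [seq i%:Z - m | i <- iota 0 (size p)]).
  exact: undup_uniq.
by move=> k; rewrite mem_undup => /laurent_supp kp; apply/funext => x.
Qed.

Lemma laurent_mul m l p q : laurent m p ** laurent l q = laurent (m + l) (p * q).
Proof.
apply/funext => n; apply/funext => x.
rewrite (@crossed_mulE _ _ _ _ _ _ _ _ [seq i%:Z - m | i <- iota 0 (size p)]).
- rewrite big_map /laurent coefz_mul /index_iota subn0.
  apply: eq_bigr => i _; rewrite subrK; congr (_ * coefz _ _).
  lia.
- rewrite map_inj_uniq ?iota_uniq// => i j /addIr; by case.
- by move=> k /laurent_supp kp; left; apply/funext => y.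
Qed.

Lemma laurent_mulXn m p n : laurent m p = laurent (m + n%:Z) (p * 'X^n).
Proof. by apply/funext => k; apply/funext => x; rewrite /laurent addrA coefz_mulXn. Qed.

Lemma laurent_eq0 m p : laurent m p = 0 -> p = 0.
Proof.
move=> p0; apply/polyP => i; rewrite coef0.
by have := congr1 (fun c => c (i%:Z - m) x0) p0; rewrite /laurent subrK.
Qed.

Lemma laurent_const (c : C) (l : nat) : laurent l (c *: 'X^l) = delta0 (fun=> c).
Proof.
rewrite -mul_polyC -[l%:Z]add0r -laurent_mulXn; apply/funext => k; apply/funext => x.
rewrite /laurent addr0 /delta0; case: k => [k|//] /=.
by rewrite coefC; case: k.
Qed.

Lemma laurentB m p q : laurent m (p - q) = laurent m p - laurent m q.
Proof.
apply/funext => k; apply/funext => x.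
rewrite -[RHS]/(coefz p (k + m) - coefz q (k + m)) /laurent.
by case: (k + m) => j /=; rewrite ?coefB ?subr0.
Qed.

Lemma laurent_surj a : CP a -> exists (m : nat) p, a = laurent m p.
Proof.
move=> /crossed_supp[s us as0]; pose m := (\max_(k <- s) `|k|)%N.
have sm k : k \in s -> (`|k| <= m)%N by move=> ks; exact: leq_bigmax_seq.
exists m, (\poly_(i < m + m.+1) a (i%:Z - m%:Z) x0).
apply/funext => k; apply/funext => x; rewrite (X_point x) /laurent.
have [ks|ks] := boolP (k \in s); last first.
  rewrite as0// /coefz; case km : (k + m%:Z) => [j|//]; rewrite coef_poly.
  by rewrite -km addrK as0// if_same.
have := sm _ ks; case km : (k + m%:Z) => [j|j] /=; last by lia.
move=> km'; rewrite coef_poly -km addrK ifT//; lia.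
Qed.

(** A root [z != 0] is dealt with by multiplying by [b - b(z)], which lies in the
    subalgebra, vanishes at [z], and is nonzero because [b] is not constant.  The
    factor for the root 0 is a unit among Laurent polynomials; the power 'X^N
    absorbs such factors. *)
Lemma product_in_subalgebra B b (rs : seq C) :
    is_subalgebra (crossed_mul sigma sigma') B -> base_algebra A `<=` B ->
    B b -> CP b -> ~ base_algebra A b ->
  exists m q N, [/\ B (laurent m q), q != 0 &
    \prod_(z <- rs) ('X - z%:P) %| q * 'X^N].
Proof.
move=> [B_submod BM] A0B Bb CPb b_nconst; have [l [r br]] := laurent_surj CPb.
have A0 c : base_algebra A (delta0 (fun=> c)).
  by exists (fun=> c) => //; exact: one_point_full.
elim: rs => [|z rs [m [q [N [Bq q0 rsq]]]]].
  exists 0, 1, 0; rewrite oner_eq0 big_nil dvd1p; split=> //.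
  have := laurent_const 1 0; rewrite expr0 scale1r => ->; exact: A0B.
have [->|z0] := eqVneq z 0.
  exists m, q, N.+1; split => //.
  by rewrite big_cons exprSr mulrA mulrC dvdp_mul// subr0.
pose c := r.[z] / z ^+ l; pose r' := r - c *: 'X^l.
have r'0 : r' != 0.
  apply/eqP => /subr0_eq rE; apply: b_nconst.
  by rewrite br rE laurent_const.
have r'z : root r' z.
  by rewrite /root !hornerE /c divfK ?expf_neq0// subrr.
exists (m + l), (q * r'), N; split.
- rewrite -laurent_mul; apply: BM => //; rewrite laurentB -br laurent_const.
  by apply: (submodB B_submod) => //; exact: A0B.
- exact: mulf_neq0.
- rewrite big_cons mulrAC mulrC; apply: dvdp_mul => //.
  by rewrite dvdp_XsubCl.
Qed.

(** Let [c] be a nonzero element of the ideal.  Up to a unit it is a polynomial,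
    which splits over the complex numbers, so [product_in_subalgebra] gives a
    nonzero multiple of [c] inside the subalgebra. *)
Lemma one_point_ip B : is_subalgebra (crossed_mul sigma sigma') B ->
    base_algebra A `<` B -> B `<=` CP ->
  intersection_property sigma sigma' A B.
Proof.
move=> B_alg [A0B nBA0] B_CP I [I_CP I_submod I_mul] I_neq0.
have [b [Bb b_nconst]] : exists b, B b /\ ~ base_algebra A b.
  apply: contrapT => /forallNP H; apply: nBA0 => b Bb.
  by apply: contrapT => nb; exact: (H b).
have [c [Ic c0]] : exists c, I c /\ c <> 0.
  apply: contrapT => /forallNP H; apply: I_neq0 => c Ic /=.
  by apply: contrapT => c0; exact: (H c).
have [m [p cp]] := laurent_surj (I_CP _ Ic).
have [rs prs] := closed_field_poly_normal p.
have p0 : p != 0.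
  apply/eqP => p0; apply: c0; rewrite cp p0; apply/funext => k; apply/funext => x.
  by rewrite /laurent; case: (k + m) => j //=; rewrite coef0.
have [n [q [N [Bq q0 rsq]]]] :=
  product_in_subalgebra rs B_alg A0B Bb (B_CP _ Bb) b_nconst.
have /dvdpP[g qg] : p %| q * 'X^N by rewrite prs dvdpZl ?lead_coef_eq0.
move=> BI0; have /BI0 : (B `&` I) (laurent n q).
  split=> //; rewrite (laurent_mulXn n q N) qg.
  have -> : n + N%:Z = (n + N%:Z - m%:Z) + m%:Z by rewrite subrK.
  rewrite -laurent_mul -cp.
  by have [] := I_mul _ _ (laurent_crossed (n + N%:Z - m%:Z) g) Ic.
by move=> /laurent_eq0/eqP; rewrite (negPf q0).
Qed.

End OnePoint.

(** * The trichotomy *)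

Theorem theorem5p4 (R : realType) (X : topologicalType)
    (X_Baire : Baire_space X) (X_Hausdorff : hausdorff_space X)
    (X_connected : connected [set: X])
    (sigma sigma' : X -> X)
    (sigma_homeo : homeomorphism_with_inverse sigma sigma')
    (A : set (X -> R[i]^o))
    (A_continuous : forall f, A f -> continuous f)
    (A_subalgebra : is_subalgebra (fun f g : X -> R[i]^o => f * g) A)
    (A_invariant : forall f, A f -> A (sigma_tilde sigma' f))
    (A_invariant_inv : forall f, A f -> A (sigma_tilde_inv sigma f))
    (A_separates : forall (U : set X) (x : X), open U -> U x ->
       exists f, [/\ A f, f x != 0 & [set y | f y != 0] `<=` U]) :
  let A0 := base_algebra A in
  let A' := commutant sigma sigma' A in
  let between := properly_between sigma sigma' A in
  let has_ip := intersection_property sigma sigma' A in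
  let Per_infty := nonperiodic sigma sigma' in
  let case1 := A0 = A' in
  let case2 := [/\ A0 `<` A', exists2 B, between B & has_ip B &
                   exists2 B, between B & ~ has_ip B] in
  let case3 := A0 `<` A' /\ (forall B, between B -> has_ip B) in
  [/\ exactly_one case1 case2 case3,
      case1 <-> dense Per_infty,
      case2 <-> ~ dense Per_infty /\ infinite_set [set: X] &
      case3 <-> exists x : X, [set: X] = [set x]].
Proof.
have sub := base_sub_commutant X_Hausdorff sigma sigma' A_subalgebra A_separates.
move=> A0 A' between has_ip Per_infty case1 case2 case3.
have c1 : case1 <-> dense Per_infty.
  exact: (dense_base_eq X_Hausdorff X_Baire sigma_homeo A_continuous A_subalgebra A_separates).
have strict : ~ dense Per_infty -> A0 `<` A'.
  move=> nd; split=> // A'A0; apply: nd; apply/c1.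
  by apply/seteqP; split.
have strict1 : A0 `<` A' -> ~ case1 by move=> [_ nA'] e; apply: nA'; rewrite -/A' -e.
have infinite_case2 : infinite_set [set: X] -> ~ dense Per_infty -> case2.
  move=> infX nd; split; first exact: strict.
  - exact: (exists_ip X_Hausdorff X_connected X_Baire sigma_homeo A_continuous).
  - exact: (exists_not_ip X_Hausdorff X_connected X_Baire sigma_homeo).
have case23 : ~ (case2 /\ case3) by move=> [[_ _ [B Bb nB]] [_ /(_ _ Bb)]].
have finite_point : ~ dense Per_infty -> ~ infinite_set [set: X] ->
    exists x, [set: X] = [set x].
  move=> nd /contrapT finX.
  have [x _] : [set: X] !=set0.
    apply: contrapT => X0; apply: nd => O [y _]; by case: X0; exists y.
  by exists x; exact: finite_connected_point.
have point_case3 : (exists x, [set: X] = [set x]) -> case3.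
  move=> [x0 X0]; have X_point x : x = x0 by have : [set: X] x by []; rewrite X0.
  split.
    apply: strict => /(_ setT (ex_intro _ x0 Logic.I) openT)[x [_ /(_ 1)]]; apply => //.
    by rewrite [LHS]X_point [RHS]X_point.
  move=> B [B_alg A0B [BA' _]].
  have [f [Af fx _]] := A_separates setT x0 openT Logic.I.
  apply: (one_point_ip X_point A_subalgebra) => //; first by exists f.
  by move=> b /BA' [].
have c2 : case2 <-> ~ dense Per_infty /\ infinite_set [set: X].
  split=> [h|[nd infX]]; last exact: infinite_case2.
  have nd : ~ dense Per_infty by case: h => /strict1 n1 _ _ /c1.
  split=> // finX; apply: case23; split=> //; apply: point_case3.
  by apply: finite_point => // /(_ finX).
have c3 : case3 <-> exists x : X, [set: X] = [set x].
  split=> // h.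
  have nd : ~ dense Per_infty by case: h => /strict1 n1 _ /c1.
  by apply: finite_point => // infX; apply: case23; split => //; exact: infinite_case2.
split=> //; split.
- have [/c1|nd] := pselect (dense Per_infty); first by left.
  have [infX|/(finite_point nd)/point_case3] := pselect (infinite_set [set: X]).
    by right; left; exact: infinite_case2.
  by right; right.
- by move=> [e [/strict1]].
- by move=> [e [/strict1]].
- exact: case23.
Qed.
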